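(* Let $\lambda > 0$ and let $f$ be a real-valued function defined on $(0,\infty)$. Then the following are equivalent: (a) $f$ is a generalized Stieltjes function of order $\lambda$, i.e. there exist a constant $C \ge 0$ and a nonnegative (Borel) measure $\rho$ on $[0,\infty)$ such that $$ f(x) = C + \int_{[0,\infty)} \frac{d\rho(t)}{(x+t)^\lambda} \quad \text{for all } x>0, $$ with the integral convergent for all $x>0$. (b) $f$ is $C^\infty$ on $(0,\infty)$, and the quantities $$ F^{[\lambda]}_{n,k}(x) = (-1)^n \sum_{j=0}^k \binom{k}{j} \frac{\Gamma(n+k+\lambda)}{\Gamma(n+j+\lambda)}\, x^j f^{(n+j)}(x) = (-1)^n\, x^{-(n+\lambda-1)} D^k \big( x^{n+k+\lambda-1} D^n f(x)\big) $$ are nonnegative for all integers $n,k \ge 0$ and all $x>0$, where $D = d/dx$.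
   Context: $\Gamma$ denotes the Euler Gamma function; $f^{(m)}$ denotes the $m$-th derivative of $f$. For $\lambda = 1$, generalized Stieltjes functions of order $1$ are the Stieltjes functions. *)

(* Defs.v *)
From HB Require Import structures.
From mathcomp Require Import all_boot all_order all_algebra.
From mathcomp Require Import all_classical all_reals all_analysis.
Set Implicit Arguments. Unset Strict Implicit. Unset Printing Implicit Defensive.
Import Order.TTheory GRing.Theory Num.Theory.
Local Open Scope classical_set_scope.
Local Open Scope ring_scope.

Definition Gamma {R : realType} (s : R) : R :=
  fine (\int[(@lebesgue_measure R)]_(t in `](0%R : R), +oo[) ((t `^ (s - 1)) * expR (- t))%:E)%E.

Definition smooth_pos {R : realType} (f : R -> R) : Prop :=
  forall (n : nat) (x : R), 0 < x -> derivable (derive1n n f) x 1.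

Definition gen_stieltjes {R : realType} (lam : R) (f : R -> R) : Prop :=
  exists (C : R) (rho : {measure set R -> \bar R}),
    0 <= C /\ rho [set t : R | t < 0] = 0%E /\
    forall x : R, 0 < x ->
      rho.-integrable `[(0%R : R), +oo[ (fun t => ((x + t) `^ (- lam))%:E) /\
      (f x)%:E = (C%:E + \int[rho]_(t in `[(0%R : R), +oo[) ((x + t) `^ (- lam))%:E)%E.

Definition F_lam {R : realType} (lam : R) (f : R -> R) (n k : nat) (x : R) : R :=
  (-1) ^+ n * \sum_(j < k.+1)
     ('C(k, j))%:R * (Gamma ((n + k)%:R + lam) / Gamma ((n + j)%:R + lam))
       * x ^+ j * derive1n (n + j) f x.

(* Main.v *)
(* Put a_n = (-1)^n f^(n)(1) / Gamma(n + lam).  Up to the positive factor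
   Gamma(n + k + lam), F^[lam]_{n,k}(1) is the alternating difference
   sum_j (-1)^j C(k,j) a_{n+j}, so condition (b) at the single point x = 1 says
   that (a_n) is a Hausdorff moment sequence: a_n is, up to the factor
   Gamma(lam), the integral of u^n against a measure on [0, 1].  The
   substitution u = 1 / (1 + t), with density u^(-lam), turns that measure
   (minus its atom at 0, which gives C) into rho, and the function g represented
   by (C, rho) has the same derivatives at 1 as f.  Condition (b) with k = 0 says
   that f is completely monotone, and so is g; such functions are real analytic
   with Taylor radius at least c at c > 0, hence f = g.
   The representing measure of a Hausdorff sequence is built as the image of
   Lebesgue measure on [0, a_0] by a limit of the quantile functions of
   Bernstein's discrete approximations.
   Conversely, for f(x) = (x + t)^(-lam) one finds
   F^[lam]_{n,k}(x) = Gamma(n + k + lam) / Gamma(lam) * t^k (x + t)^(-lam-n-k). *)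

Require Import Defs.
From HB Require Import structures.
From mathcomp Require Import all_boot all_order all_algebra.
From mathcomp Require Import all_classical all_reals all_analysis.
From mathcomp Require Import measurable_realfun.
From mathcomp Require Import ring lra zify.
Import Order.TTheory GRing.Theory Num.Theory.
Import numFieldNormedType.Exports.
Local Open Scope classical_set_scope.
Local Open Scope ring_scope.
Set Implicit Arguments.
Unset Strict Implicit.

(** * Completely monotone functions *)

Lemma ge0_derive_le (R : realType) (F dF : R -> R) (a b : R) :
  a <= b -> (forall x, a <= x <= b -> is_derive x 1 F (dF x)) ->
  (forall x, a <= x <= b -> 0 <= dF x) -> F a <= F b.
Proof.
move=> ab dFE dF0.
have [||c] := @MVT_segment R F dF a b ab.
- by move=> x xab; apply: dFE; rewrite !ltW ?(itvP xab).
- apply: derivable_within_continuous => x; rewrite in_itv /= => xab.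
  by have [] := dFE _ xab.
- rewrite in_itv/= => cab E.
  by rewrite -subr_ge0 E mulr_ge0 ?dF0// subr_ge0.
Qed.

Lemma is_derive_scaled_monomial (R : realType) (M s : R) (n : nat) :
  is_derive s 1 (fun t : R => M * (t ^+ n.+1 / n.+1`!%:R))
    (M * (s ^+ n / n`!%:R)).
Proof.
have n0 : (n`!)%:R != 0 :> R by rewrite pnatr_eq0 -lt0n fact_gt0.
have n1 : 1 + n%:R != 0 :> R by rewrite nat1r pnatr_eq0.
rewrite [X in is_derive _ _ X _](_ : _ =
  (M / n.+1`!%:R) \*: (@id R ^+ n.+1)); last first.
  by apply/funext => t; rewrite /= fctE [RHS]mulrAC mulrA.
apply: is_derive_eq; rewrite /GRing.scale/= mulr1 factS natrM.
by field; rewrite n0 n1.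
Qed.

(** Taylor's remainder estimate along a segment parametrised by [[0, 1]]. The inductive hypothesis
    bounds [e 1] by a multiple of [t ^+ N / N!]. Comparing [e 0] from both sides with the primitive
    of this bound gives the next order, with no integral form of the remainder. *)
Lemma taylor_unit_bound (R : realType) (N : nat) (e : nat -> R -> R) (M s : R) :
  (forall n (t : R), 0 <= t <= 1 -> is_derive t 1 (e n) (e n.+1 t)) ->
  (forall n, (n < N)%N -> e n 0 = 0) ->
  (forall t : R, 0 <= t <= 1 -> `|e N t| <= M) ->
  0 <= s <= 1 -> `|e 0%N s| <= M * (s ^+ N / N`!%:R).
Proof.
elim: N e s => [|N IH] e s de e0 eM /andP[s0 s1].
  by rewrite expr0 divr1 mulr1 eM// s0.
have e1 t : 0 <= t <= 1 -> `|e 1%N t| <= M * (t ^+ N / N`!%:R).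
  by apply: (IH (fun n => e n.+1)) => // n nN; rewrite e0.
have ts t : 0 <= t <= s -> 0 <= t <= 1.
  by move=> /andP[-> ts]; exact: le_trans ts s1.
rewrite ler_norml; apply/andP; split.
  rewrite -subr_ge0 opprK.
  have := @ge0_derive_le R (fun t => e 0%N t + M * (t ^+ N.+1 / N.+1`!%:R))
    (fun t => e 1%N t + M * (t ^+ N / N`!%:R)) 0 s s0.
  rewrite expr0n/= mul0r mulr0 addr0 e0//; apply => t /ts t01.
    have ? := de 0%N _ t01; have ? := is_derive_scaled_monomial M t N.
    exact: is_deriveD.
  by have := e1 _ t01; rewrite ler_norml => /andP[]; rewrite -subr_ge0 opprK.
rewrite -subr_ge0.
have := @ge0_derive_le R (fun t => M * (t ^+ N.+1 / N.+1`!%:R) - e 0%N t)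
  (fun t => M * (t ^+ N / N`!%:R) - e 1%N t) 0 s s0.
rewrite expr0n/= mul0r mulr0 e0// subr0; apply => t /ts t01.
  have ? := de 0%N _ t01; have ? := is_derive_scaled_monomial M t N.
  exact: is_deriveB.
by have := e1 _ t01; rewrite ler_norml => /andP[]; rewrite -(subr_ge0 (e 1%N t)).
Qed.

(* u n plays the role of (-1)^n f^(n); carrying the whole sequence makes
   "u (. + m) is again such a sequence" definitional. *)
Definition alternating_tower {R : realType} (u : nat -> R -> R) : Prop :=
  forall (n : nat) (x : R),
    0 < x -> is_derive x 1 (u n) (- u n.+1 x) /\ 0 <= u n x.

Lemma alternating_tower_shift (R : realType) (u : nat -> R -> R) (m : nat) :
  alternating_tower u -> alternating_tower (fun n => u (n + m)%N).
Proof. by move=> Hu n x x0; have [] := Hu (n + m)%N x x0. Qed.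

Lemma is_derive_affine (R : realType) (F : R -> R) (a b s l : R) :
  is_derive (a + b * s) 1 F l ->
  is_derive s 1 (fun t => F (a + b * t)) (b * l).
Proof.
move=> dF.
have dg : is_derive s 1 (fun t : R => a + b * t) b.
  have -> : (fun t : R => a + b * t) = cst a + b \*: id by [].
  by apply: is_derive_eq; rewrite add0r /GRing.scale/= mulr1.
by have := @is_derive1_comp R F (fun t => a + b * t) s l b dF dg; rewrite mulrC.
Qed.

(** All Taylor terms of [u 0] at [y], taken at the point [y - h] to the left, are nonnegative, so
    each one alone is at most the value there. The induction differentiates the difference in [h]
    and uses the bound of order [n] for the shifted tower. *)
Lemma alternating_tower_bound (R : realType) (u : nat -> R -> R) (n : nat) (y h : R) :
  alternating_tower u -> 0 <= h -> h < y ->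
  u n y * (h ^+ n / n`!%:R) <= u 0%N (y - h).
Proof.
move=> Hu; elim: n u Hu h => [|n IH] u Hu h h0 hy.
  rewrite expr0 divr1 mulr1.
  have := @ge0_derive_le R (fun s => u 0%N (y + (-1) * s)) (fun s => u 1%N (y - s)) 0 h h0.
  rewrite mulr0 addr0 mulN1r; apply => s /andP[s0 sh].
    have ys : 0 < y + -1 * s by rewrite mulN1r subr_gt0 (le_lt_trans sh).
    have [/is_derive_affine + _] := Hu 0%N _ ys.
    by rewrite !mulN1r opprK.
  by have [] := Hu 1%N (y - s); rewrite ?subr_gt0// (le_lt_trans sh).
have Hu1 := alternating_tower_shift 1 Hu.
have y0 : 0 < y by exact: le_lt_trans hy.
rewrite -subr_ge0.
have := @ge0_derive_le R (fun s => u 0%N (y + (-1) * s) - u n.+1 y * (s ^+ n.+1 / n.+1`!%:R))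
  (fun s => u 1%N (y - s) - u n.+1 y * (s ^+ n / n`!%:R)) 0 h h0.
rewrite mulr0 addr0 mulN1r expr0n/= mul0r mulr0 subr0 => H.
apply: le_trans (H _ _); first by have [] := Hu 0%N y y0.
- move=> s /andP[s0 sh].
  have ys : 0 < y + -1 * s by rewrite mulN1r subr_gt0 (le_lt_trans sh).
  have [/is_derive_affine + _] := Hu 0%N _ ys.
  rewrite !mulN1r opprK => ?.
  have ? := is_derive_scaled_monomial (u n.+1 y) s n.
  exact: is_deriveB.
- move=> s /andP[s0 sh]; rewrite subr_ge0.
  by have := IH _ Hu1 s s0 (le_lt_trans sh hy); rewrite addn1.
Qed.

(** The two strict inequalities on [x] and [c] say that [|x - c|] is below [min(c, x)]. On the
    segment between them the n-th derivatives are O(n! / h^n) for some [h] above [|x - c|], so the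
    Taylor remainder of the difference decays geometrically. *)
Lemma alternating_tower_eq_near (R : realType) (u v : nat -> R -> R) (c x : R) :
  alternating_tower u -> alternating_tower v -> 0 < c -> 0 < x ->
  (forall n, u n c = v n c) -> x < 2 * c -> c < 2 * x -> u 0%N x = v 0%N x.
Proof.
move=> Hu Hv c0 x0 uv xc cx.
set m := Num.min c x.
have [mc mx] : m <= c /\ m <= x by split; rewrite ge_min lexx ?orbT.
set k := `|x - c|.
have km : k < m.
  rewrite /k /m; case: (lerP x c) => H; rewrite ?ler0_norm ?gtr0_norm ?subr_le0 ?subr_gt0//.
    by lra.
  by lra.
(* [k < h] makes the ratio [k / h] less than 1, and [h < m] keeps [y - h] positive for every [y] on
   the segment. *)
pose h := (k + m) / 2.
have [kh hm] : k < h /\ h < m by rewrite /h; split; lra.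
have k0 : 0 <= k by exact: normr_ge0.
have h0 : 0 < h by exact: le_lt_trans kh.
pose B := u 0%N (m - h) + v 0%N (m - h).
have mh0 : 0 < m - h by rewrite subr_gt0.
have dec w y : alternating_tower w -> m <= y -> w 0%N (y - h) <= w 0%N (m - h).
  move=> Hw my.
  have ym : y - m < y - h by rewrite ltrD2l ltrN2.
  have := @alternating_tower_bound _ w 0 (y - h) (y - m) Hw.
  rewrite expr0 divr1 mulr1 subr_ge0 => /(_ my ym).
  by rewrite (_ : y - h - (y - m) = m - h)//; ring.
(* A Cauchy-type estimate, uniform in [y >= m] because [w 0] is nonincreasing. *)
have bd w n y : alternating_tower w -> m <= y ->
    w n y <= w 0%N (m - h) * (n`!%:R / h ^+ n).
  move=> Hw my.
  have := @alternating_tower_bound _ w n y h Hw (ltW h0) (lt_le_trans hm my).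
  move=> /le_trans/(_ (dec _ _ Hw my)).
  by rewrite -ler_pdivlMr ?invf_div// divr_gt0 ?exprn_gt0// ltr0n fact_gt0.
have bound N : `|u 0%N x - v 0%N x| <= B * (k / h) ^+ N.
  have pos t : 0 <= t <= 1 -> m <= c + (x - c) * t.
    move=> /andP[t0 t1].
    have : 0 <= (c - m) * (1 - t) + (x - m) * t.
      by rewrite addr_ge0// mulr_ge0// subr_ge0.
    lra.
  (* The factor [(- (x - c)) ^+ n] combines the chain rule for the affine parametrisation with the
     sign in [u n' = - u n.+1]. The bound carries [N!] to cancel the denominator of the
     remainder. *)
  have := @taylor_unit_bound R N
    (fun n t => (u n (c + (x - c) * t) - v n (c + (x - c) * t)) * (- (x - c)) ^+ n)
    (B * (k / h) ^+ N * N`!%:R) 1.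
  have -> : c + (x - c) * 1 = x by ring.
  rewrite expr0 mulr1 expr1n mulrA mulr1 mulfK; last by rewrite pnatr_eq0 -lt0n fact_gt0.
  apply; last by rewrite ler01 lexx.
  - move=> n t /pos t01; have t0 : 0 < c + (x - c) * t.
      by rewrite (lt_le_trans _ t01)// (le_lt_trans k0).
    have [/is_derive_affine du _] := Hu n _ t0.
    have [/is_derive_affine dv _] := Hv n _ t0.
    rewrite [X in is_derive _ _ X _](_ : _ =
      (- (x - c)) ^+ n \*: ((fun t => u n (c + (x - c) * t))
        - (fun t => v n (c + (x - c) * t)))); last first.
      by apply/funext => z /=; rewrite [RHS]mulrC.
    by apply: is_derive_eq; rewrite /GRing.scale/= exprS; ring.
  - by move=> n _; rewrite mulr0 addr0 uv subrr mul0r.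
  - move=> t /pos mt; rewrite normrM normrX normrN -/k.
    have -> : B * (k / h) ^+ N * N`!%:R = B * (N`!%:R / h ^+ N) * k ^+ N.
      by rewrite expr_div_n; field; rewrite expf_neq0 ?gt_eqF.
    rewrite ler_wpM2r ?exprn_ge0// (le_trans (ler_normB _ _))// [leRHS]mulrDl.
    have cm : 0 < c + (x - c) * t by rewrite (lt_le_trans _ mt)// (le_lt_trans k0).
    have [_ un0] := Hu N _ cm; have [_ vn0] := Hv N _ cm.
    by rewrite !ger0_norm ?lerD ?bd.
have kh1 : `|k / h| < 1.
  by rewrite (ger0_norm (divr_ge0 k0 (ltW h0))) ltr_pdivrMr ?mul1r.
have : `|u 0%N x - v 0%N x| <= 0.
  have lim0 : (fun N => B * (k / h) ^+ N) @ \oo --> (B * 0).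
    by apply: cvgMr; exact: cvg_expr.
  rewrite mulr0 in lim0.
  rewrite -(cvg_lim _ lim0)//; apply: limr_ge; first by apply/cvg_ex; exists 0.
  by apply: nearW => N; exact: bound.
by rewrite normr_le0 subr_eq0 => /eqP.
Qed.

(** Local equality spreads from a centre to points within a factor 2. Steps of ratio 3/2 therefore
    reach every positive point from 1. *)
Lemma alternating_tower_eq (R : realType) (u v : nat -> R -> R) (x : R) :
  alternating_tower u -> alternating_tower v ->
  (forall n, u n 1 = v n 1) -> 0 < x -> u 0%N x = v 0%N x.
Proof.
move=> Hu Hv uv1 x0.
have near_eq c y n : 0 < c -> 0 < y -> (forall n, u n c = v n c) ->
    y < 2 * c -> c < 2 * y -> u n y = v n y.
  move=> c0 y0 uvc yc cy.
  by apply: (@alternating_tower_eq_near _ _ _ c y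
    (alternating_tower_shift n Hu) (alternating_tower_shift n Hv)).
(* Agreement on [[(2/3)^N, (3/2)^N]], for all orders [n] at once, since every point reached serves
   as the next Taylor centre. *)
have grow N : forall y n, 1 <= y * (3 / 2) ^+ N -> y <= (3 / 2) ^+ N -> u n y = v n y.
  elim: N => [|N IH] y n.
    rewrite expr0 mulr1 => y1 y2.
    by have -> : y = 1 by apply/le_anti; rewrite y1 y2.
  have q1 : 1 <= (3 / 2 : R) ^+ N by rewrite exprn_ege1//; lra.
  set q := (3 / 2) ^+ N in q1 IH; rewrite exprSr -/q => y1 y2.
  have y0 : 0 < y.
    by rewrite -(@pmulr_lgt0 _ (q * (3 / 2))) ?(lt_le_trans ltr01 y1)//; lra.
  have [y_ge1|y_lt1] := leP 1 y.
    (* Moving [y] back by the factor 2/3, but not past 1, gives a centre already covered by the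
       induction hypothesis. *)
    apply: (near_eq (Num.max 1 (y * (2 / 3)))) => //; rewrite ?lt_max ?ltr01//.
    - by move=> k; apply: IH; case: (lerP 1 (y * (2 / 3))) => H; nra.
    - by case: (lerP 1 (y * (2 / 3))) => H; lra.
    - by case: (lerP 1 (y * (2 / 3))) => H; lra.
  apply: (near_eq (Num.min 1 (y * (3 / 2)))) => //.
  - by case: (lerP 1 (y * (3 / 2))) => H; lra.
  - by move=> k; apply: IH; case: (lerP 1 (y * (3 / 2))) => H; nra.
  - by case: (lerP 1 (y * (3 / 2))) => H; lra.
  - by case: (lerP 1 (y * (3 / 2))) => H; lra.
have pow_ge N : N%:R / 2 <= (3 / 2 : R) ^+ N.
  elim: N => [|N IH]; first by rewrite expr0; lra.
  have q1 : 1 <= (3 / 2 : R) ^+ N by rewrite exprn_ege1//; lra.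
  by rewrite exprSr -natr1; lra.
(* [x + x^-1] bounds [x] and its inverse together; the factor 2 compensates the 1/2 in [pow_ge]. *)
pose N := Num.truncn (2 * (x + x^-1)).
have xV0 : 0 < x^-1 by rewrite invr_gt0.
have Nx : x + x^-1 < (3 / 2) ^+ N.+1.
  have : 2 * (x + x^-1) < N.+1%:R by rewrite truncnS_gt.
  by have := pow_ge N.+1; lra.
apply: (grow N.+1); last lra.
by rewrite mulrC -ler_pdivrMr// mul1r; lra.
Qed.

(** * The Gamma function *)

(** The boundary term at infinity in the integration by parts for Gamma. With [k >= s], the
    exponential exceeds its Taylor term of order [k + 1], which leaves a harmonic upper bound. *)
Lemma powR_expRN_cvg0 (R : realType) (s : R) :
  (fun n : nat => n.+2%:R `^ s * expR (- n.+2%:R)) @ \oo --> (0 : R).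
Proof.
pose k := (Num.truncn `|s|).+1.
have sk : s <= k%:R by rewrite (le_trans (ler_norm s))// ltW// truncnS_gt.
have ub (n : nat) : n.+2%:R `^ s * expR (- n.+2%:R) <= (k.+1)`!%:R * (n.+1%:R)^-1 :> R.
  have n2 : 0 < n.+2%:R :> R by rewrite ltr0n.
  rewrite expRN ler_pdivrMr ?expR_gt0//.
  have /(_ k) H := @expR_ge1Dxn R n.+2%:R _ (ltW n2).
  apply: (@le_trans _ _ (n.+2%:R ^+ k)).
    by rewrite -powR_mulrn ?ler_powR// ?ler1n// ltW.
  rewrite -ler_pdivrMl ?mulr_gt0 ?invr_gt0 ?ltr0n ?fact_gt0//.
  rewrite invfM invrK; apply: le_trans (H); rewrite -[leLHS]add0r lerD//.
  rewrite exprS [leRHS]mulrC -[leLHS]mulrA ler_wpM2l ?invr_ge0 ?ler0n//.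
  by rewrite ler_wpM2r ?exprn_ge0 ?(ltW n2)// ler_nat.
apply: (@squeeze_cvgr _ _ _ _ (cst 0) (fun n => (k.+1)`!%:R * (n.+1%:R)^-1)).
- by apply: nearW => n; rewrite ub andbT mulr_ge0 ?powR_ge0 ?expR_ge0.
- exact: cvg_cst.
- rewrite -[X in _ --> X](mulr0 ((k.+1)`!%:R : R)); apply: cvgMr; exact: cvg_harmonic.
Qed.

(** Kept in the extended reals, so that the functional equation can be proved before finiteness and
    then used to derive it. *)
Definition gamma_integral {R : realType} (s : R) : \bar R :=
  (\int[(@lebesgue_measure R)]_(t in `](0%R : R), +oo[)
     ((t `^ (s - 1)) * expR (- t))%:E)%E.

(** A compact exhaustion of the positive half-line. The shift by 2 keeps the endpoints distinct even
    for [n = 0], as integration by parts requires. *)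
Definition invS_itv (R : realType) (n : nat) : set R := [set` `[(n.+2%:R)^-1, n.+2%:R]].

Lemma bigcup_itv_invS (R : realType) :
  \bigcup_n @invS_itv R n = [set` `]0, +oo[].
Proof.
apply/seteqP; split => [x [n _]/=|x].
  rewrite /invS_itv/= !in_itv/= andbT => /andP[nx _].
  by rewrite (lt_le_trans _ nx)// invr_gt0 ltr0n.
rewrite /= in_itv/= andbT => x0; exists (Num.truncn (x + x^-1)) => //=.
have xV0 : 0 < x^-1 by rewrite invr_gt0.
have H : x + x^-1 < (Num.truncn (x + x^-1)).+2%:R.
  by rewrite (lt_trans (truncnS_gt _))// ltr_nat.
rewrite /invS_itv/= in_itv/=; apply/andP; split; last by apply: ltW; lra.
by rewrite -[leRHS]invrK lef_pV2 ?posrE ?ltr0n//; apply: ltW; lra.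
Qed.

Lemma continuous_powR_pos (R : realType) (s x : R) :
  0 < x -> {for x, continuous (fun t : R => t `^ s)}.
Proof.
move=> x0; apply: differentiable_continuous; apply/derivable1_diffP.
by apply: derivable_powR; rewrite in_itv/= x0.
Qed.

Lemma is_derive_expRN (R : realType) (x : R) :
  is_derive x 1 (fun t : R => - expR (- t)) (expR (- x)).
Proof.
have ? : is_derive x 1 (fun t : R => expR (- t)) (- expR (- x)).
  by have := @is_derive1_comp R expR -%R x _ _ (is_derive_expR _) (is_deriveNid _ _);
    rewrite mulrN1.
by apply: is_derive_eq; rewrite opprK.
Qed.

Lemma measurable_gamma_integrand (R : realType) (s : R) (D : set R) :
  measurable_fun D (fun t : R => (t `^ (s - 1) * expR (- t))%:E).
Proof.
apply/measurable_EFinP/measurable_funM.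
  exact: (measurable_funTS (@measurable_powR R (s - 1))).
exact: (measurableT_comp (@measurable_expR R) (@oppr_measurable R D)).
Qed.

Lemma gamma_integral_cvg (R : realType) (s : R) :
  (\int[(@lebesgue_measure R)]_(t in @invS_itv R n)
     ((t `^ (s - 1)) * expR (- t))%:E)%E @[n --> \oo] --> gamma_integral s.
Proof.
rewrite /gamma_integral -bigcup_itv_invS.
apply: ge0_nondecreasing_set_cvg_integral.
- apply/nondecreasing_seqP => n; rewrite subsetEset => x; rewrite /invS_itv/= !in_itv/=.
  move=> /andP[nx xn]; rewrite (le_trans _ nx) ?(le_trans xn) ?ler_nat//.
  by rewrite lef_pV2 ?posrE ?ltr0n// ler_nat.
- by move=> n; exact: measurable_itv.
- by move=> n; exact: measurable_gamma_integrand.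
- by move=> n x _; rewrite lee_fin mulr_ge0 ?powR_ge0 ?expR_ge0.
Qed.

(** Integration by parts on each compact interval, then monotone convergence. The boundary term at 0
    vanishes because [s > 0], the one at infinity by exponential decay. *)
Lemma gamma_integralS (R : realType) (s : R) :
  0 < s -> gamma_integral (s + 1) = (s%:E * gamma_integral s)%E.
Proof.
move=> s0.
have parts (n : nat) :
    (\int[(@lebesgue_measure R)]_(t in @invS_itv R n)
       ((t `^ (s + 1 - 1)) * expR (- t))%:E)%E =
    (((n.+2%:R)^-1 `^ s * expR (- (n.+2%:R)^-1) - n.+2%:R `^ s * expR (- n.+2%:R))%:E +
     s%:E * \int[(@lebesgue_measure R)]_(t in @invS_itv R n)
       ((t `^ (s - 1)) * expR (- t))%:E)%E.
  have n0 : 0 < (n.+2%:R)^-1 :> R by rewrite invr_gt0 ltr0n.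
  have ab : (n.+2%:R)^-1 < n.+2%:R :> R.
    by rewrite (@lt_trans _ _ 1)// ?ltr1n// invf_lt1 ?ltr1n.
  have pos x : x \in `[(n.+2%:R)^-1, n.+2%:R] -> 0 < x :> R.
    by rewrite in_itv/= => /andP[nx _]; exact: lt_le_trans nx.
  have cpow p : {within `[(n.+2%:R)^-1, n.+2%:R], continuous (fun t : R => t `^ p)}.
    apply: continuous_in_subspaceT => x /set_mem/= xI.
    exact/continuous_powR_pos/pos.
  have cspow : {within `[(n.+2%:R)^-1, n.+2%:R], continuous (fun t : R => s * t `^ (s - 1))}.
    apply: continuous_in_subspaceT => x /set_mem/= xI; apply: cvgMl_tmp.
    exact/continuous_powR_pos/pos.
  have dpow : derivable_oo_LRcontinuous (fun t : R => t `^ s) (n.+2%:R)^-1 n.+2%:R.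
    split.
    - move=> x xI; have x0 : 0 < x by apply: pos; exact: subset_itv_oo_cc xI.
      by apply: derivable_powR; rewrite in_itv/= x0.
    - by apply: cvg_at_right_filter; exact: continuous_powR_pos.
    - by apply: cvg_at_left_filter; apply: continuous_powR_pos; rewrite ltr0n.
  have cexp : continuous (fun t : R => expR (- t)).
    by move=> x; apply: continuous_comp; [exact: continuousN|exact: continuous_expR].
  have dexp : derivable_oo_LRcontinuous (fun t : R => - expR (- t)) (n.+2%:R)^-1 n.+2%:R.
    split.
    - by move=> x _; have [] := is_derive_expRN x.
    - by apply: cvg_at_right_filter; apply: cvgN; exact: cexp.
    - by apply: cvg_at_left_filter; apply: cvgN; exact: cexp.
  rewrite addrK (@integration_by_parts R (fun t => t `^ s) (fun t => - expR (- t))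
    (fun t => s * t `^ (s - 1)) (fun t => expR (- t)) _ _ ab) //.
  - rewrite !mulrN opprK; congr (_ + _)%E; first by rewrite addrC.
    rewrite -ge0_integralZl_EFin//=; last 4 first.
    + exact: measurable_itv.
    + by move=> t _; rewrite lee_fin mulr_ge0 ?powR_ge0 ?expR_ge0.
    + exact: measurable_gamma_integrand.
    + exact: ltW.
    under [in LHS]eq_integral do rewrite mulrN EFinN.
    rewrite integral_ge0N ?oppeK.
      by apply: eq_integral => t _; rewrite -EFinM mulrA.
    by move=> t _; rewrite lee_fin !mulr_ge0 ?powR_ge0 ?expR_ge0// ltW.
  - move=> x xI; rewrite powR_derive1// in_itv/= andbT.
    by apply: pos; exact: subset_itv_oo_cc xI.
  - exact: continuous_subspaceT.
  - by move=> x _; rewrite derive1E; have [] := is_derive_expRN x.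
have := @gamma_integral_cvg R (s + 1).
under eq_fun do rewrite parts.
move=> /(cvg_lim _) <-//; apply/cvg_lim => //.
rewrite -[X in _ --> X]add0e; apply: cvgeD.
- by rewrite fin_num_adde_defr.
- apply: cvg_EFin; first exact: nearW.
  rewrite -[X in _ --> X](subr0 0); apply: cvgB; last exact: powR_expRN_cvg0.
  have invn0 : (fun n : nat => (n.+2%:R)^-1 : R) @ \oo --> (0 : R).
    by have := @cvg_harmonic R; rewrite -(cvg_shiftn 1); under eq_fun do rewrite addn1.
  have /cvg_at_rightP/(_ (fun n : nat => (n.+2%:R)^-1 : R)) H := powR_cvg0 s0.
  apply: (@squeeze_cvgr _ _ _ _ (cst 0) (fun n : nat => (n.+2%:R)^-1 `^ s)).
  + apply: nearW => n; rewrite mulr_ge0 ?powR_ge0 ?expR_ge0//=.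
    by rewrite ler_piMr ?powR_ge0// expR_le1 oppr_le0 invr_ge0.
  + exact: cvg_cst.
  + by apply: H; split => // n; rewrite invr_gt0 ltr0n.
- by apply: cvgeZl => //; exact: gamma_integral_cvg.
Qed.

(** For such [s], [t^(s-1) <= 1 + t <= 2 exp(t/2)], so the integrand is at most [2 exp(-t/2)], whose
    integral is 4. *)
Lemma gamma_integral_lty (R : realType) (s : R) :
  1 <= s -> s <= 2 -> (gamma_integral s < +oo)%E.
Proof.
move=> s1 s2.
have cexp2 (c : R) : continuous (fun t : R => c * expR (- (t / 2))).
  move=> t; apply: cvgMl_tmp; apply: continuous_comp; last exact: continuous_expR.
  by apply: cvgN; apply: cvgMr_tmp.
have I : (\int[(@lebesgue_measure R)]_(t in `[(0%R : R), +oo[)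
   (2 * expR (- (t / 2)))%:E)%E = 4%:E.
  have dF (x : R) : is_derive x 1 (fun t : R => - (4 * expR (- (t / 2)))) (2 * expR (- (x / 2))).
    have := @is_derive_expRN R (0 + 2^-1 * x).
    move=> /is_derive_affine H.
    rewrite [X in is_derive _ _ X _](_ : _ =
      4 \*: (fun t : R => - expR (- (0 + 2^-1 * t)))); last first.
      by apply/funext => t /=; rewrite [RHS]mulrN add0r [2^-1 * t]mulrC.
    by apply: is_derive_eq; rewrite /GRing.scale/= add0r mulrC [_^-1 * x]mulrC; field.
  have := @ge0_continuous_FTC2y R (fun t : R => 2 * expR (- (t / 2)))
    (fun t : R => - (4 * expR (- (t / 2)))) 0 0; cbv beta.
  rewrite mul0r oppr0 expR0 mulr1 -EFinB opprK add0r; apply.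
  - by move=> x _; rewrite mulr_ge0 ?expR_ge0.
  - exact: continuous_subspaceT.
  - rewrite -[X in _ --> X]oppr0 -[X in _ --> - X](mulr0 (4 : R)).
    apply: cvgN; apply: cvgMl_tmp.
    apply: (@cvg_comp _ _ _ (fun x : R => x / 2) (fun y => expR (- y)) +oo%R +oo%R).
      by apply: gt0_cvgMly.
    exact: cvgr_expR.
  - by move=> x _; have [] := dF x.
  - have := @cexp2 4 0; rewrite /continuous_at mul0r oppr0 expR0 mulr1 => c4.
    by apply: cvg_at_right_filter; apply: cvgN; exact: c4.
  - by move=> x _; rewrite derive1E; have [] := dF x.
apply: (@le_lt_trans _ _ (4%R : R)%:E); last by rewrite ltry.
rewrite -I /gamma_integral.
apply: (@le_trans _ _ (\int[(@lebesgue_measure R)]_(t in `](0%R : R), +oo[)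
   (2 * expR (- (t / 2)))%:E)%E).
  apply: ge0_le_integral => //.
  - by move=> t _; rewrite lee_fin mulr_ge0 ?powR_ge0 ?expR_ge0.
  - exact: measurable_gamma_integrand.
  - apply/measurable_EFinP.
    exact: (measurable_funTS (continuous_measurable_fun (@cexp2 2))).
  - move=> t; rewrite /= in_itv/= andbT => t0; rewrite lee_fin.
    have -> : - t = - (t / 2) - t / 2 by field.
    rewrite expRD mulrA ler_wpM2r ?expR_ge0//.
    rewrite expRN ler_pdivrMr ?expR_gt0//.
    apply: (@le_trans _ _ (1 + t)).
      have [t1|t1] := leP 1 t.
        rewrite (@le_trans _ _ t)//; last lra.
        by rewrite -{2}(powRr1 (ltW t0)) ler_powR//; lra.
      rewrite (@le_trans _ _ 1)//; last lra.
      have t01 : 0 < t <= 1 by rewrite t0 ltW.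
      by rewrite (le_trans (ger_powR t01 (_ : 0 <= s - 1))) ?powRr0 ?subr_ge0.
    by have := @expR_ge1Dx R (t / 2); lra.
apply: ge0_subset_integral => //.
- apply/measurable_EFinP.
  exact: (measurable_funTS (continuous_measurable_fun (@cexp2 2))).
- by apply: subset_itvr; rewrite bnd_simp.
Qed.

Lemma gamma_integral_gt0 (R : realType) (s : R) :
  1 <= s -> (0 < gamma_integral s)%E.
Proof.
move=> s1.
apply: (@lt_le_trans _ _ (\int[(@lebesgue_measure R)]_(t in `[(1%R : R), 2%R])
   (expR (- 2))%:E)%E).
  rewrite integral_cst//= lebesgue_measure_itv/= lte_fin ltr1n.
  by rewrite -EFinB -EFinM lte_fin mulr_gt0 ?expR_gt0//; lra.
apply: (@le_trans _ _ (\int[(@lebesgue_measure R)]_(t in `[(1%R : R), 2%R])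
   ((t `^ (s - 1)) * expR (- t))%:E)%E).
  apply: ge0_le_integral => //.
  - exact: measurable_gamma_integrand.
  - move=> t; rewrite /= in_itv/= => /andP[t1 t2].
    rewrite lee_fin -[leLHS]mul1r ler_pM ?expR_ge0// ?ler_expR ?lerN2//.
    by rewrite (le_trans _ (@ler_powR _ t t1 0 (s - 1) _)) ?powRr0 ?subr_ge0.
apply: ge0_subset_integral => //.
- exact: measurable_gamma_integrand.
- by move=> t _; rewrite lee_fin mulr_ge0 ?powR_ge0 ?expR_ge0.
- by apply: subset_itv; rewrite bnd_simp.
Qed.

(** The functional equation moves [s] upwards into [[1, +oo[] for positivity; for finiteness it
    lowers a large [s] by unit steps and lifts [s <= 1] into [[1, 2]]. *)
Lemma gamma_integral_bounds (R : realType) (s : R) :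
  0 < s -> (0 < gamma_integral s < +oo)%E.
Proof.
move=> s0; apply/andP; split.
  have [s1|s1] := leP 1 s; first exact: gamma_integral_gt0.
  have : (0 < gamma_integral (s + 1))%E by apply: gamma_integral_gt0; lra.
  by rewrite gamma_integralS// pmule_rgt0.
have [n] : exists n : nat, s <= n.+1%:R.
  by exists (Num.truncn s); rewrite ltW// truncnS_gt.
elim: n s s0 => [|n IH] s s0 sn.
  have : (gamma_integral (s + 1) < +oo)%E by apply: gamma_integral_lty; lra.
  rewrite gamma_integralS//; case: (gamma_integral s) => [r _|//|//]; first exact: ltry.
  by rewrite gt0_muley.
have [s1|s1] := leP s 1.
  by apply: IH => //; rewrite (le_trans s1)// ler1n.
rewrite -(subrK 1 s) gamma_integralS ?subr_gt0//.
have : (gamma_integral (s - 1) < +oo)%E.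
  by apply: IH; [rewrite subr_gt0|rewrite lerBlDr natr1].
case: (gamma_integral _) => [r _|//|_]; first exact: ltry.
by rewrite gt0_muleNy ?ltNyy// lte_fin subr_gt0.
Qed.

Lemma GammaS (R : realType) (s : R) : 0 < s -> Gamma (s + 1) = s * Gamma s.
Proof.
move=> s0; rewrite /Gamma -!/(gamma_integral _) gamma_integralS//.
by rewrite fineM// gt0_fin_numE; have /andP[] := gamma_integral_bounds s0.
Qed.

Lemma Gamma_gt0 (R : realType) (s : R) : 0 < s -> 0 < Gamma s.
Proof.
by move=> s0; rewrite /Gamma -/(gamma_integral _) fine_gt0// gamma_integral_bounds.
Qed.

(** * The Hausdorff moment problem *)

(* The value at u^n (1 - u)^k of the functional sending u^m to a m. *)
Definition hausdorff_diff {R : realType} (a : nat -> R) (k n : nat) : R :=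
  \sum_(j < k.+1) (-1) ^+ j * 'C(k, j)%:R * a (n + j)%N.

(** Apply the linear functional sending [X^i] to [a i] to the expansion of
    [((1 - X) + X)^M * X^m = X^m]. *)
Lemma sum_bin_hausdorff_diff (R : realType) (a : nat -> R) (M m : nat) :
  \sum_(j < M.+1) 'C(M, j)%:R * hausdorff_diff a (M - j) (m + j) = a m.
Proof.
(* A common length exceeding every degree that occurs, so that [L] is one fixed finite sum and is
   visibly linear. *)
pose B := (M + m).+1.
pose L (p : {poly R}) := \sum_(i < B) p`_i * a i.
have Lsum n (F : 'I_n -> {poly R}) : L (\sum_(i < n) F i) = \sum_(i < n) L (F i).
  rewrite /L exchange_big/=; apply: eq_bigr => i _.
  by rewrite coef_sum mulr_suml.
have LZ c p : L (c *: p) = c * L p.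
  by rewrite /L mulr_sumr; apply: eq_bigr => i _; rewrite coefZ mulrA.
have LX n : (n < B)%N -> L 'X^n = a n.
  move=> nB; rewrite /L (bigD1 (Ordinal nB))//= coefXn eqxx mul1r big1 ?addr0//.
  by move=> i /eqP ni; rewrite coefXn; case: eqP => [e|_]; rewrite ?mul0r//;
    case: ni; apply: val_inj.
have LD k n : (n + k < B)%N -> L ((1 - 'X) ^+ k * 'X^n) = hausdorff_diff a k n.
  move=> nkB; rewrite exprDn mulr_suml Lsum; apply: eq_bigr => j _.
  rewrite expr1n mul1r [(- 'X) ^+ _]exprNn -[_ *+ _]mulr_natl -!mulrA -exprD mulrA.
  have -> : 'C(k, j)%:R * (-1) ^+ j = ((-1) ^+ j * 'C(k, j)%:R)%:P :> {poly R}.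
    by rewrite rmorphM/= rmorphXn/= rmorphN1 rmorph_nat mulrC.
  rewrite mul_polyC LZ LX; first by rewrite addnC mulrA.
  by rewrite addnC (leq_ltn_trans _ nkB)// leq_add2l -ltnS.
have mB : (m < B)%N by rewrite ltnS leq_addl.
have e1 : L 'X^m = L ((1 - 'X + 'X) ^+ M * 'X^m) by rewrite subrK expr1n mul1r.
rewrite -(LX m mB) e1 exprDn mulr_suml Lsum.
apply: eq_bigr => j _.
have jM : (j <= M)%N by exact: leq_ord.
have jB : (m + j + (M - j) < B)%N.
  by rewrite /B ltnS -addnA (subnKC jM) addnC.
rewrite -(LD _ _ jB).
rewrite -LZ; apply: f_equal.
rewrite -mul_polyC rmorph_nat -[in RHS]mulr_natl.
by rewrite -!mulrA -exprD [(j + m)%N]addnC.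
Qed.

(** Multiplied by [j! (M - j)!], both sides become [(m + M)!]. *)
Lemma bin_ffact_shift (m M j : nat) : (j <= M)%N ->
  ('C(M, j) * (m + M) ^_ m = 'C(m + M, m + j) * (m + j) ^_ m)%N.
Proof.
move=> jM.
have pos : (0 < j`! * (M - j)`!)%N by rewrite muln_gt0 !fact_gt0.
apply/eqP; rewrite -(eqn_pmul2r pos); apply/eqP.
transitivity ((m + M)`!)%N.
  have := ffact_fact (leq_addr M m); rewrite addKn => <-.
  by rewrite -[in RHS](bin_fact jM) mulnA [('C(M, j) * _)%N]mulnC -!mulnA.
have mjM : (m + j <= m + M)%N by rewrite leq_add2l.
have := bin_fact mjM; have := ffact_fact (leq_addr j m); rewrite addKn subnDl => <- <-.
by rewrite !mulnA.
Qed.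

(** With falling factorials in place of the powers [(k / N)^m], Bernstein's discrete measures have
    the moments [a m] exactly, for every [N >= m]. *)
Lemma hausdorff_moment_ffact (R : realType) (a : nat -> R) (m N : nat) : (m <= N)%N ->
  \sum_(k < N.+1) ('C(N, k)%:R * hausdorff_diff a (N - k) k) * ((k ^_ m)%:R / (N ^_ m)%:R)
  = a m.
Proof.
move=> /subnKC <-; set M := (N - m)%N.
have D0 : ((m + M) ^_ m)%:R != 0 :> R by rewrite pnatr_eq0 -lt0n ffact_gt0 leq_addr.
rewrite -addnS big_split_ord/= big1 ?add0r; last first.
  by move=> i _; rewrite ffact_small ?mul0r ?mulr0.
rewrite -[RHS](sum_bin_hausdorff_diff a M m); apply: eq_bigr => j _.
have jM : (j <= M)%N by rewrite -ltnS.
rewrite subnDl mulrAC; congr (_ * _).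
by apply: (mulIf D0); rewrite -!mulrA mulVf// mulr1 -!natrM bin_ffact_shift.
Qed.

(** [phi] is a primitive of the monotone [h], described only by the inequalities it satisfies, so
    that it can be an explicit piecewise linear function as well as a Lebesgue integral. The gap
    between left and right sums telescopes to the stated error. *)
Lemma monotone_riemann_sum (R : realType) (h phi : R -> R) (A : R) (n : nat) :
  0 <= A -> (0 < n)%N ->
  (forall s t, 0 <= s -> s <= t -> t <= A ->
     (t - s) * h s <= phi t - phi s /\ phi t - phi s <= (t - s) * h t) ->
  `|phi A - phi 0 - A / n%:R * \sum_(i < n) h (i%:R * (A / n%:R))|
    <= A / n%:R * (h A - h 0).
Proof.
move=> A0 n0 H; set d := A / n%:R.
have nR : 0 < n%:R :> R by rewrite ltr0n.
have d0 : 0 <= d by rewrite divr_ge0// ltW.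
have nd : n%:R * d = A by rewrite /d mulrC divfK// gt_eqF.
have tele (u : R -> R) : u A - u 0 = \sum_(i < n) (u (i.+1%:R * d) - u (i%:R * d)).
  rewrite -(big_mkord xpredT (fun i => u (i.+1%:R * d) - u (i%:R * d))).
  by rewrite (telescope_sumr (fun i => u (i%:R * d)))// nd mul0r.
have step (i : 'I_n) : d * h (i%:R * d) <= phi (i.+1%:R * d) - phi (i%:R * d) /\
    phi (i.+1%:R * d) - phi (i%:R * d) <= d * h (i.+1%:R * d).
  have E : i.+1%:R * d - i%:R * d = d by rewrite -mulrBl -natrB// subSnn mul1r.
  have := H (i%:R * d) (i.+1%:R * d); rewrite E; apply.
  - by rewrite mulr_ge0.
  - by rewrite ler_wpM2r// ler_nat.
  - by rewrite -nd ler_wpM2r// ler_nat.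
rewrite ger0_norm; last first.
  by rewrite subr_ge0 tele mulr_sumr; apply: ler_sum => i _; have [] := step i.
rewrite (tele h) (tele phi) !mulr_sumr -sumrB; apply: ler_sum => i _.
by rewrite mulrBr lerB//; have [] := step i.
Qed.

(** * Quantile functions of finitely supported measures *)

Section discrete_quantile.
Context {R : realType} (p : nat -> R) (N : nat).
Hypothesis p_ge0 : forall k, (k <= N)%N -> 0 <= p k.

Let P (k : nat) : R := \sum_(i < k.+1) p i.

(* The quantile function of the measure putting mass p k at k <= N. *)
Definition discrete_quantile (s : R) : nat := \sum_(k < N) (P k <= s)%R.

Lemma discrete_quantile_le s : (discrete_quantile s <= N)%N.
Proof.
rewrite -[X in (_ <= X)%N](card_ord N) -sum1_card.
by apply: leq_sum => k _; case: (_ <= _).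
Qed.

Lemma discrete_quantile_nd : {homo discrete_quantile : s t / s <= t >-> (s <= t)%N}.
Proof.
move=> s t st; apply: leq_sum => k _.
by case: (leP (P k) s) => [Ps|//]; rewrite (le_trans Ps st).
Qed.

Let P_le j k : (j <= k)%N -> (k <= N)%N -> P j <= P k.
Proof.
move=> jk kN; rewrite -(subnKC jk) /P -addSn big_split_ord/= lerDl.
by apply: sumr_ge0 => i _; apply: p_ge0; rewrite (leq_trans _ kN)//;
  case: i => i /=; lia.
Qed.

(** The partial sums [P k] are nondecreasing, so the indices with [P k <= s] form an initial segment
    whose length is the quantile, and the increments of [g] over it telescope. *)
Lemma discrete_quantile_layer_cake (g : nat -> R) (s : R) :
  g (discrete_quantile s) =
  g 0%N + \sum_(k < N) (g k.+1 - g k) * (P k <= s)%R%:R.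
Proof.
suff H M : (M <= N)%N -> g (\sum_(k < M) (P k <= s)%R)%N =
  g 0%N + \sum_(k < M) (g k.+1 - g k) * (P k <= s)%R%:R by exact: H.
elim: M => [_|M IH MN]; first by rewrite !big_ord0 addr0.
rewrite !big_ord_recr/= addrA -IH ?(ltnW MN)//.
case: (leP (P M) s) => Ps; last by rewrite addn0 mulr0 addr0.
have -> : (\sum_(k < M) (P k <= s)%R = M)%N.
  rewrite -[RHS]card_ord -sum1_card; apply: eq_bigr => k _.
  by rewrite (le_trans _ Ps)// P_le// ltnW.
by rewrite addn1 mulr1 addrC subrK.
Qed.

Lemma sum_by_parts (g : nat -> R) :
  \sum_(k < N.+1) p k * g k =
  g 0%N * P N + \sum_(k < N) (g k.+1 - g k) * (P N - P k).
Proof.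
clear p_ge0; elim: N => [|M IH].
  by rewrite /P !big_ord1 big_ord0 addr0 mulrC.
have PS : P M.+1 = P M + p M.+1 by rewrite /P big_ord_recr.
rewrite big_ord_recr/= IH [in RHS]big_ord_recr/= PS.
have -> : \sum_(k < M) (g k.+1 - g k) * (P M + p M.+1 - P k) =
  \sum_(k < M) (g k.+1 - g k) * (P M - P k) + (g M - g 0%N) * p M.+1.
  rewrite -(telescope_sumr g)// big_mkord mulr_suml -big_split/=.
  by apply: eq_bigr => k _; ring.
by ring.
Qed.

(** The error depends only on the total mass, the mesh and the range of [g]; this uniformity lets
    the estimate survive the limit in [N]. *)
Lemma discrete_quantile_riemann_sum (g : nat -> R) (n : nat) : (0 < n)%N ->
  (forall k, g k <= g k.+1) ->
  `|\sum_(k < N.+1) p k * g k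
    - P N / n%:R * \sum_(i < n) g (discrete_quantile (i%:R * (P N / n%:R)))|
  <= P N / n%:R * (g N - g 0%N).
Proof.
move=> n0 gS.
have g_le : {homo g : i j / (i <= j)%N >-> i <= j}.
  by apply: homo_leq => //; exact: le_trans.
have P0 k : (k <= N)%N -> 0 <= P k.
  by move=> kN; apply: sumr_ge0 => i _; apply: p_ge0; case: i => i /=; lia.
(* The primitive of the layer-cake formula: the indicator of [P k <= s] integrates to the positive
   part of [s - P k]. *)
pose phi s := g 0%N * s + \sum_(k < N) (g k.+1 - g k) * Num.max (s - P k) 0.
have -> : \sum_(k < N.+1) p k * g k = phi (P N) - phi 0.
  rewrite sum_by_parts /phi mulr0 add0r [X in _ - X]big1 ?subr0; last first.
    by move=> k _; rewrite max_r ?mulr0// sub0r oppr_le0 P0// ltnW.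
  congr (_ + _); apply: eq_bigr => k _.
  by rewrite max_l// subr_ge0 P_le// ltnW.
have PN0 : 0 <= P N by exact: P0.
have H := @monotone_riemann_sum R (fun s => g (discrete_quantile s)) phi _ _ PN0 n0.
apply: le_trans (H _) _ => {H}.
  move=> s t s0 st tA.
  have -> : phi t - phi s = (t - s) * g 0%N +
    \sum_(k < N) (g k.+1 - g k) * (Num.max (t - P k) 0 - Num.max (s - P k) 0).
    rewrite (eq_bigr (fun k : 'I_N => (g k.+1 - g k) * Num.max (t - P k) 0 -
      (g k.+1 - g k) * Num.max (s - P k) 0)).
      by rewrite sumrB /phi; ring.
    by move=> k _; rewrite mulrBr.
  rewrite !discrete_quantile_layer_cake !mulrDr !mulr_sumr.
  split; rewrite lerD2l; apply: ler_sum => k _; rewrite mulrCA ler_wpM2l ?subr_ge0 ?gS//.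
    case: (leP (P k) s) => Ps /=; rewrite ?mulr1 ?mulr0.
      by rewrite !max_l ?subr_ge0// ?(le_trans Ps)//; lra.
    by case: (lerP (t - P k) 0) => Pt; case: (lerP (s - P k) 0) => Ps'; lra.
  case: (leP (P k) t) => Pt /=; rewrite ?mulr1 ?mulr0.
    by case: (lerP (t - P k) 0) => Pt'; case: (lerP (s - P k) 0) => Ps'; lra.
  by rewrite !max_r ?subrr// subr_le0 ltW// (le_lt_trans st).
by rewrite ler_wpM2l ?divr_ge0// lerB// g_le// discrete_quantile_le.
Qed.

End discrete_quantile.

(** Compactness gives a cluster point, and a cluster point of an ultrafilter is a limit. *)
Lemma ultra_cvg_segment (R : realType) (T : Type) (U : set_system T)
    (UU : UltraFilter U) (u : T -> R) (a b : R) :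
  (forall i, a <= u i <= b) -> cvg (u @ U).
Proof.
move=> uab.
have [|p [_ pcl]] := @segment_compact R a b (u @ U).
  by apply: (@filterS _ U _ setT) filterT => i _ /=; rewrite in_itv/= uab.
apply/cvg_ex; exists p => B pB.
have [//|UC] := in_ultra_setVsetC (u @^-1` B) UU.
by have [x []] := pcl (~` B) B UC pB.
Qed.

Lemma integrable_homo_bounded (R : realType) (h : R -> R) (a b : R) :
  {homo h : x y / x <= y} -> (forall x, 0 <= h x <= 1) ->
  (@lebesgue_measure R).-integrable `[a, b] (EFin \o h).
Proof.
move=> h_nd h01; apply: measurable_bounded_integrable.
- exact: measurable_itv.
- by rewrite /= lebesgue_measure_itv/=; case: ifP => // _; rewrite -EFinB ltry.
- exact: nondecreasing_measurable.
- exists 1; split => [|M M1 x _]; first exact: num_real.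
  by have /andP[h0 h1] := h01 x; rewrite /= ger0_norm// (le_trans h1)// ltW.
Qed.

Lemma homo_integral_riemann_sum (R : realType) (h : R -> R) (A : R) (n : nat) :
  {homo h : x y / x <= y} -> (forall x, 0 <= h x <= 1) -> 0 <= A -> (0 < n)%N ->
  `|(\int[@lebesgue_measure R]_(x in `[0, A]) h x)
     - A / n%:R * \sum_(i < n) h (i%:R * (A / n%:R))| <= A / n%:R.
Proof.
move=> h_nd h01 A0 n0.
pose phi t := (\int[@lebesgue_measure R]_(x in `[0%R, t]) h x)%R.
have phi0 : phi 0 = 0.
  by rewrite /phi set_itv1 /Rintegral integral_set1.
have := @monotone_riemann_sum R h phi A n A0 n0.
rewrite phi0 subr0 => H; apply: le_trans (H _) _ => {H}.
  move=> s t s0 st tA.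
  have -> : phi t - phi s = \int[@lebesgue_measure R]_(x in `]s, t]) h x.
    by rewrite /phi Rintegral_itvB//; exact: integrable_homo_bounded.
  have ih : (@lebesgue_measure R).-integrable `]s, t] (EFin \o h).
    apply: integrableS (integrable_homo_bounded s t h_nd h01) => //.
    by apply: subset_itvr; rewrite bnd_simp.
  have ic c : (@lebesgue_measure R).-integrable `]s, t] (EFin \o cst c).
    apply: measurable_bounded_integrable => //.
    - by rewrite /= lebesgue_measure_itv/=; case: ifP => // _; rewrite -EFinB ltry.
    - by exists `|c|; split => [|M cM x _]; [exact: num_real|exact: ltW].
  have E c : (t - s) * c = \int[@lebesgue_measure R]_(x in `]s, t]) (cst c x).
    rewrite Rintegral_cst//= lebesgue_measure_itv/= lte_fin [RHS]mulrC.
    congr (_ * _); move: st; rewrite le_eqVlt => /predU1P[->|->//].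
    by rewrite ltxx subrr.
  rewrite !E; split; apply: le_Rintegral => // x /=; rewrite in_itv/= => /andP[sx xt].
    exact/h_nd/ltW.
  exact: h_nd.
have /andP[? ?] := h01 A; have /andP[? ?] := h01 0.
by rewrite ler_piMr ?divr_ge0//; lra.
Qed.

Lemma leq_ffactS (m k : nat) : (k ^_ m <= k.+1 ^_ m)%N.
Proof.
by elim: m => // m IH; rewrite !ffactnSr leq_mul// leq_sub2r.
Qed.

(** [Q] is the pointwise limit of the rescaled quantiles. Both [a m] and the integral of [Q ^+ m]
    are within [a 0 / n] of the same Riemann sum, so only finite sums have to pass to the
    ultrafilter limit. *)
Lemma hausdorff_moment (R : realType) (a : nat -> R) :
  (forall n k, 0 <= hausdorff_diff a k n) ->
  exists Q : R -> R, [/\ {homo Q : x y / x <= y}, (forall x, 0 <= Q x <= 1) &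
    forall m, \int[@lebesgue_measure R]_(x in `[0, a 0%N]) (Q x ^+ m) = a m].
Proof.
move=> a_pos.
pose p N k := 'C(N, k)%:R * hausdorff_diff a (N - k) k.
have p0 N k : (k <= N)%N -> 0 <= p N k by move=> _; rewrite mulr_ge0.
have psum N : \sum_(i < N.+1) p N i = a 0%N.
  rewrite -(@hausdorff_moment_ffact R a 0 N)//; apply: eq_bigr => i _.
  by rewrite !ffactn0 divr1 mulr1.
pose K N s := discrete_quantile (p N) N s.
(* An ultrafilter limit replaces Helly's diagonal extraction. *)
have [U [UU UF]] := ultraFilterLemma (@eventually_filter).
pose u s N : R := (K N s)%:R / N%:R.
have u01 s N : 0 <= u s N <= 1.
  rewrite divr_ge0//=; case: N => [|N]; first by rewrite /u invr0 mulr0.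
  by rewrite ler_pdivrMr ?ltr0n// mul1r ler_nat discrete_quantile_le.
have ucvg s : cvg (u s @ U) by exact: ultra_cvg_segment.
pose Q s := lim (u s @ U).
have near_ge (m : nat) : \forall N \near U, (m <= N)%N by apply: UF; exact: nbhs_infty_ge.
have Q01 s : 0 <= Q s <= 1.
  apply/andP; split.
    by apply: limr_ge => //; apply: nearW => N; have /andP[] := u01 s N.
  by apply: limr_le => //; apply: nearW => N; have /andP[] := u01 s N.
have Qnd : {homo Q : x y / x <= y}.
  move=> x y xy; apply: ler_lim => //; apply: nearW => N.
  by rewrite ler_wpM2r ?invr_ge0// ler_nat discrete_quantile_nd.
have invU : (fun N : nat => (N%:R)^-1 : R) @ U --> (0 : R).
  apply: cvg_trans (_ : (fun N : nat => (N%:R)^-1 : R) @ \oo --> (0 : R)).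
    by apply: cvg_app; exact: UF.
  rewrite -(cvg_shiftn 1) /=; under eq_fun do rewrite addn1.
  exact: cvg_harmonic.
(* Each new factor [(K - m) / (N - m)] equals [(K/N - m/N) / (1 - m/N)], which has the same limit as
   [K / N]. *)
have gcvg m s : (fun N => (K N s ^_ m)%:R / (N ^_ m)%:R : R) @ U --> Q s ^+ m.
  elim: m => [|m IH].
    under eq_fun do rewrite !ffactn0 divr1.
    exact: cvg_cst.
  have : (fun N => (u s N - m%:R * (N%:R)^-1) / (1 - m%:R * (N%:R)^-1)) @ U -->
      (Q s - m%:R * 0) / (1 - m%:R * 0).
    apply: cvgM; first by apply: cvgB; [exact: ucvg|exact: cvgMl_tmp].
    apply: cvgV; first by rewrite mulr0 subr0 oner_eq0.
    by apply: cvgB; [exact: cvg_cst|exact: cvgMl_tmp].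
  rewrite mulr0 !subr0 divr1 => H; rewrite exprSr; apply: cvg_trans (cvgM IH H); apply: near_eq_cvg.
  near=> N.
  have mN : (m < N)%N by near: N; exact: near_ge.
  have N0 : N%:R != 0 :> R by rewrite pnatr_eq0 -lt0n (leq_ltn_trans _ mN).
  have NN : N%:R - m%:R != 0 :> R by rewrite subr_eq0 eqr_nat gtn_eqF.
  rewrite !ffactnSr !natrM (natrB _ (ltnW mN)) /u.
  (* Truncated subtraction is harmless: when [K N s < m] the falling factorial in front is already
     0. *)
  have -> : (K N s ^_ m)%:R * (K N s - m)%:R = (K N s ^_ m)%:R * ((K N s)%:R - m%:R) :> R.
    have [mK|Km] := leqP m (K N s); first by rewrite natrB.
    by rewrite ffact_small// !mul0r.
  have NM : (N ^_ m)%:R != 0 :> R by rewrite pnatr_eq0 -lt0n ffact_gt0 ltnW.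
  by rewrite /=; field; rewrite NN NM N0.
have a0 : 0 <= a 0%N by rewrite -(psum 0%N) sumr_ge0// => i _; rewrite p0// -ltnS.
exists Q; split => // m.
have riemann n : (0 < n)%N ->
    `|a m - a 0%N / n%:R * (\sum_(i < n) Q (i%:R * (a 0%N / n%:R)) ^+ m) | <= a 0%N / n%:R.
  move=> n0.
  have lim_sum : (fun N => `|a m - a 0%N / n%:R *
      (\sum_(i < n) (K N (i%:R * (a 0%N / n%:R)) ^_ m)%:R / (N ^_ m)%:R) |) @ U -->
      `|a m - a 0%N / n%:R * (\sum_(i < n) Q (i%:R * (a 0%N / n%:R)) ^+ m) |.
    apply: cvg_norm; apply: cvgB; first exact: cvg_cst.
    apply: cvgMl_tmp.
    rewrite [X in X @ U](_ : _ = \sum_(i < n) (fun N : nat =>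
      (K N (i%:R * (a 0%N / n%:R)) ^_ m)%:R / (N ^_ m)%:R : R)); last first.
      by apply/funext => N; rewrite fct_sumE.
    elim/big_ind2: _ => [|? ? ? ? H1 H2|i _]; first exact: cvg_cst.
      exact: cvgD H1 H2.
    exact: gcvg.
  rewrite -(cvg_lim _ lim_sum)//; apply: limr_le; first by apply/cvg_ex; eexists; exact: lim_sum.
  near=> N.
  have mN : (m <= N)%N by near: N; exact: near_ge.
  have NM : 0 < (N ^_ m)%:R :> R by rewrite ltr0n ffact_gt0.
  rewrite -[X in X - _](hausdorff_moment_ffact a mN).
  have := @discrete_quantile_riemann_sum R (p N) N (@p0 N)
    (fun k => (k ^_ m)%:R / (N ^_ m)%:R) n n0.
  rewrite psum => H; apply: le_trans (H _) _.
    by move=> k; rewrite ler_wpM2r ?invr_ge0// ler_nat leq_ffactS.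
  by rewrite divff ?gt_eqF// ler_piMr ?divr_ge0//.
have Qm_nd : {homo (fun x => Q x ^+ m) : x y / x <= y}.
  move=> x y xy; have /andP[Qx _] := Q01 x.
  by rewrite lerXn2r ?nnegrE ?Qnd// (le_trans Qx)// Qnd.
have Qm01 x : 0 <= Q x ^+ m <= 1.
  by have /andP[Q0 Q1] := Q01 x; rewrite exprn_ge0//= exprn_ile1.
apply/eqP; rewrite -subr_eq0 -normr_le0.
set I := Rintegral _ _ _.
have bound n : `|I - a m| <= 2 * a 0%N * (n.+1%:R)^-1.
  have H1 := homo_integral_riemann_sum Qm_nd Qm01 a0 (ltn0Sn n).
  have H2 := riemann _ (ltn0Sn n); rewrite -/I in H1.
  move: H1 H2; set S := _ * \sum_(_ < _) _ => H1 H2.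
  rewrite (_ : I - a m = (I - S) - (a m - S)); last by ring.
  rewrite (le_trans (ler_normB _ _))//.
  have -> : 2 * a 0%N * (n.+1%:R)^-1 = a 0%N / n.+1%:R + a 0%N / n.+1%:R by ring.
  exact: lerD.
have lim0 : (fun n : nat => 2 * a 0%N * (n.+1%:R)^-1) @ \oo --> (0 : R).
  by rewrite -[X in _ --> X](mulr0 (2 * a 0%N)); apply: cvgMl_tmp; exact: cvg_harmonic.
rewrite -(cvg_lim _ lim0)//; apply: limr_ge; first by apply/cvg_ex; exists 0.
by apply: nearW => n; exact: bound.
Unshelve. all: by end_near.
Qed.

(** * Differentiating a Stieltjes integral *)

Section stieltjes_kernel.
Context {R : realType} (rho : {measure set R -> \bar R}).

Definition kernel_integrable (p : R) : Prop := forall x : R, 0 < x ->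
  rho.-integrable `[(0%R : R), +oo[ (fun t => ((x + t) `^ (- p))%:E).

Definition kernel_integral (p x : R) : R :=
  \int[rho]_(t in `[(0%R : R), +oo[) ((x + t) `^ (- p)).

Lemma powR_shift_opp1 (p x t : R) : 0 < x + t ->
  (x + t) `^ (- (p + 1)) = (x + t) `^ (- p) * (x + t)^-1.
Proof.
move=> xt; rewrite opprD powRD; last by rewrite (gt_eqF xt) implybT.
by rewrite powR_inv1// ltW.
Qed.

Lemma measurable_kernel (p x : R) (D : set R) :
  measurable_fun D (fun t : R => (x + t) `^ p).
Proof.
apply: measurable_funTS.
apply: (measurableT_comp (@measurable_powR R p)).
exact: measurable_funD.
Qed.

Lemma kernel_integrableS (p : R) : kernel_integrable p -> kernel_integrable (p + 1).
Proof.
move=> ip x x0.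
have mD : measurable (`[(0%R : R), +oo[%classic : set R) by exact: measurable_itv.
apply: (le_integrable mD _ _ (integrableZl mD x^-1 (ip x x0))).
- by apply/measurable_EFinP; exact: measurable_kernel.
- move=> t; rewrite /= in_itv/= andbT => t0.
  have xt : 0 < x + t by rewrite ltr_wpDr.
  rewrite lee_fin powR_shift_opp1// !ger0_norm ?mulr_ge0 ?powR_ge0 ?invr_ge0 ?(ltW xt) ?(ltW x0)//.
  by rewrite mulrC ler_wpM2r ?powR_ge0// lef_pV2 ?posrE// lerDl.
Qed.

Lemma is_derive_kernel (p x t : R) : 0 < x + t ->
  is_derive x 1 (fun y => (y + t) `^ (- p)) (- p * (x + t) `^ (- (p + 1))).
Proof.
move=> xt; have dP := @is_derive1_powR R (- p) (x + t) xt.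
have dg : is_derive x 1 (fun y : R => y + t) 1.
  have -> : (fun y : R => y + t) = id + cst t by [].
  by apply: is_derive_eq; rewrite addr0.
have := @is_derive1_comp R (fun y => y `^ (- p)) (fun y => y + t) x _ _ dP dg.
by rewrite mulr1 opprD.
Qed.

Lemma is_derive_kernel_integral (p x : R) : 0 < p -> kernel_integrable p -> 0 < x ->
  is_derive x 1 (kernel_integral p) (- p * kernel_integral (p + 1) x).
Proof.
move=> p0 ip x0.
have ip1 := kernel_integrableS ip.
(* The kernel's derivative decreases in absolute value as [y] grows, so on []x / 2, 2 * x[] its
   value at the left end dominates. *)
pose G (t : R) := p * (x / 2 + t) `^ (- (p + 1)).
have x2 : 0 < x / 2 by rewrite divr_gt0.
pose k := fun y t : R => (y + t) `^ (- p).
have Ix : (`]x / 2, 2 * x[)%classic x by rewrite /= in_itv/=; apply/andP; split; lra.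
have intk y : `]x / 2, 2 * x[%classic y -> rho.-integrable `[(0%R : R), +oo[ (EFin \o k y).
  by rewrite /= in_itv/= => /andP[xy _]; apply: ip; exact: lt_trans xy.
have pos y t : `]x / 2, 2 * x[%classic y -> `[(0%R : R), +oo[%classic t -> 0 < y + t.
  by rewrite /= !in_itv/= andbT => /andP[xy _] t0; rewrite ltr_wpDr// (lt_trans x2).
have derk y t : `]x / 2, 2 * x[%classic y -> `[(0%R : R), +oo[%classic t ->
    derivable (k ^~ t) y 1.
  by move=> yI tI; have [] := is_derive_kernel p (pos _ _ yI tI).
have derkE y t : `]x / 2, 2 * x[%classic y -> `[(0%R : R), +oo[%classic t ->
    partial1of2 k y t = - p * (y + t) `^ (- (p + 1)).
  by move=> yI tI; rewrite partial1of2E; have [] := is_derive_kernel p (pos _ _ yI tI).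
have mD : measurable (`[(0%R : R), +oo[%classic : set R) by exact: measurable_itv.
have G0 t : 0 <= G t by rewrite mulr_ge0 ?powR_ge0// ltW.
have intG : rho.-integrable `[(0%R : R), +oo[ (EFin \o G).
  exact: (integrableZl mD p (ip1 _ x2)).
have Gub y t : `]x / 2, 2 * x[%classic y -> `[(0%R : R), +oo[%classic t ->
    `|partial1of2 k y t| <= G t.
  move=> yI tI; rewrite derkE// normrM normrN !ger0_norm ?powR_ge0 ?(ltW p0)//.
  rewrite ler_wpM2l ?(ltW p0)//.
  have yt := pos _ _ yI tI.
  have xt : 0 < x / 2 + t.
    by move: tI; rewrite /= in_itv/= andbT => t0; rewrite ltr_wpDr.
  rewrite !powRN lef_pV2 ?posrE ?powR_gt0//.
  have p1 : 0 <= p + 1 by rewrite addr_ge0// ltW.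
  rewrite ge0_ler_powR ?nnegrE ?(ltW xt) ?(ltW yt)//.
  by rewrite lerD2r; move: yI; rewrite /= in_itv/= => /andP[/ltW].
have dI := @derivable_under_integral R _ _ rho k _ mD x _ _ Ix intk derk G G0 intG Gub.
have eI := @differentiation_under_integral R _ _ rho k _ mD x _ _ Ix intk derk G G0 intG Gub.
apply: DeriveDef; first exact: dI.
rewrite -derive1E eI -RintegralZl//; last exact: ip1.
by apply: eq_Rintegral => t; rewrite inE => tI; rewrite derkE.
Qed.

Lemma Rintegral_sum_ord (n : nat) (D : set R) (h : 'I_n -> R -> R) : measurable D ->
  (forall i, rho.-integrable D (EFin \o h i)) ->
  \int[rho]_(t in D) (\sum_(i < n) h i t) = \sum_(i < n) \int[rho]_(t in D) h i t.
Proof.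
move=> mD; elim: n h => [|n IH] h ih.
  rewrite big_ord0 (@eq_Rintegral _ _ _ _ D (cst 0)) ?Rintegral_cst ?mul0r//.
  by move=> t _; rewrite big_ord0.
rewrite big_ord_recr/= -IH; last by move=> i; exact: ih.
rewrite -RintegralD//.
  by apply: eq_Rintegral => t _; rewrite big_ord_recr.
rewrite (_ : _ \o _ = (fun t => \sum_(i < n) (h (widen_ord (leqnSn n) i) t)%:E)%E).
  by apply: integrable_sum => // i _; exact: ih.
by apply/funext => t /=; rewrite sumEFin.
Qed.

End stieltjes_kernel.

(** The n-th derivative of the represented function, times [(-1)^n]. The Gamma quotient is the
    rising factorial [lam (lam + 1) ... (lam + n - 1)]. *)
Definition stieltjes_tower {R : realType} (lam C : R) (rho : {measure set R -> \bar R})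
    (n : nat) (x : R) : R :=
  Gamma (n%:R + lam) / Gamma lam * kernel_integral rho (n%:R + lam) x
  + (if n is 0 then C else 0).

Section stieltjes_tower.
Context {R : realType} (lam C : R) (rho : {measure set R -> \bar R}).
Hypotheses (lam0 : 0 < lam) (C0 : 0 <= C) (irho : kernel_integrable rho lam).

Lemma nat_lam_gt0 (n : nat) : 0 < n%:R + lam.
Proof. by rewrite ltr_wpDl. Qed.

Lemma Gamma_nat_gt0 (n : nat) : 0 < Gamma (n%:R + lam).
Proof. exact/Gamma_gt0/nat_lam_gt0. Qed.

Lemma kernel_integrable_nat (n : nat) : kernel_integrable rho (n%:R + lam).
Proof.
elim: n => [|n IH]; first by rewrite add0r.
by rewrite -natr1 addrAC; exact: kernel_integrableS.
Qed.

Lemma stieltjes_tower_alternating : alternating_tower (stieltjes_tower lam C rho).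
Proof.
move=> n x x0; split.
  have dk := is_derive_kernel_integral (nat_lam_gt0 n) (kernel_integrable_nat n) x0.
  have -> : stieltjes_tower lam C rho n =
      (Gamma (n%:R + lam) / Gamma lam) \*: kernel_integral rho (n%:R + lam)
      + cst (if n is 0 then C else 0) by [].
  apply: is_derive_eq.
  have E : n.+1%:R + lam = n%:R + lam + 1 by rewrite -natr1 addrAC.
  rewrite /stieltjes_tower E GammaS ?nat_lam_gt0// !addr0 /GRing.scale/=.
  by ring.
apply: addr_ge0; last by case: n.
apply: mulr_ge0.
  by apply: divr_ge0; apply: ltW; [exact: Gamma_nat_gt0|exact: Gamma_gt0].
by apply: Rintegral_ge0 => t _; exact: powR_ge0.
Qed.

(** The Gamma factors leave the common quotient [Gamma(n + k + lam) / Gamma(lam)]. Under the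
    integral, the binomial theorem gives [(x + t)^(-(n + lam)) (1 - x / (x + t))^k], which is
    nonnegative for [t >= 0]. *)
Lemma stieltjes_tower_binomial_sum_ge0 (n k : nat) (x : R) : 0 < x ->
  0 <= \sum_(j < k.+1) 'C(k, j)%:R * (Gamma ((n + k)%:R + lam) / Gamma ((n + j)%:R + lam))
       * (- x) ^+ j * stieltjes_tower lam C rho (n + j) x.
Proof.
move=> x0.
have mD : measurable (`[(0%R : R), +oo[%classic : set R) by exact: measurable_itv.
pose h (j : 'I_k.+1) (t : R) := ('C(k, j)%:R * (- x) ^+ j) * (x + t) `^ (- ((n + j)%:R + lam)).
have hint : 0 <= \sum_(j < k.+1) \int[rho]_(t in `[(0%R : R), +oo[) h j t.
  rewrite -Rintegral_sum_ord//; last first.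
    by move=> j; exact: (integrableZl mD _ (kernel_integrable_nat _ x0)).
  apply: Rintegral_ge0 => t; rewrite /= in_itv/= andbT => t0.
  have xt : 0 < x + t by rewrite ltr_wpDr.
  have -> : \sum_(j < k.+1) h j t = (x + t) `^ (- (n%:R + lam)) * (1 - x / (x + t)) ^+ k.
    rewrite exprDn mulr_sumr; apply: eq_bigr => j _.
    rewrite expr1n mul1r /h natrD addrAC [in LHS]opprD powRD; last first.
      by rewrite (gt_eqF xt) implybT.
    rewrite powR_invn ?(ltW xt)// -mulNr expr_div_n -[_ *+ _]mulr_natl.
    by ring.
  rewrite mulr_ge0 ?powR_ge0// exprn_ge0// subr_ge0 ler_pdivrMr// mul1r.
  by rewrite lerDl.
have hE (j : 'I_k.+1) : \int[rho]_(t in `[(0%R : R), +oo[) h j t =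
    'C(k, j)%:R * (- x) ^+ j * kernel_integral rho ((n + j)%:R + lam) x.
  by rewrite /h RintegralZl//; exact: kernel_integrable_nat.
have Gl0 : Gamma lam != 0 by rewrite gt_eqF// Gamma_gt0.
have -> : \sum_(j < k.+1) 'C(k, j)%:R * (Gamma ((n + k)%:R + lam) / Gamma ((n + j)%:R + lam))
       * (- x) ^+ j * stieltjes_tower lam C rho (n + j) x =
   Gamma ((n + k)%:R + lam) / Gamma lam *
     (\sum_(j < k.+1) \int[rho]_(t in `[(0%R : R), +oo[) h j t + (if n is 0 then C else 0)).
  (* The constant [C] enters only through the term [n = j = 0]. *)
  have -> : (if n is 0 then C else 0) = \sum_(j < k.+1) if (n + j)%N is 0 then C else 0.
    rewrite big_ord_recl big1 ?addr0 /=; first by rewrite addn0.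
    by move=> i _; rewrite addnS.
  rewrite -big_split mulr_sumr; apply: eq_bigr => j _; rewrite /= hE /stieltjes_tower.
  have Gj0 : Gamma ((n + j)%:R + lam) != 0 by rewrite gt_eqF// Gamma_nat_gt0.
  have c1 : Gamma ((n + j)%:R + lam) / Gamma lam * (if (n + j)%N is 0 then C else 0) =
      (if (n + j)%N is 0 then C else 0).
    by case: (n + j)%N => [|i]; rewrite ?mulr0// add0r divff ?mul1r.
  have c2 : 'C(k, j)%:R * (- x) ^+ j * (if (n + j)%N is 0 then C else 0) =
      (if (n + j)%N is 0 then C else 0).
    case E : (n + j)%N => [|i]; last by rewrite mulr0.
    have -> : j = 0%N :> nat by move: E; lia.
    by rewrite bin0 expr0 !mul1r.
  rewrite -[in LHS]c1 -[in RHS]c2; move: Gj0 Gl0 {c1 c2}.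
  move: (kernel_integral _ _ _) (if _ is 0 then _ else _).
  move: (Gamma _) (Gamma _) (Gamma _) => g1 g2 g3 K c g2_0 g3_0.
  by field; rewrite g2_0 g3_0.
apply: mulr_ge0.
  by apply: divr_ge0; apply: ltW; [exact: Gamma_nat_gt0|exact: Gamma_gt0].
by rewrite addr_ge0//; case: (n).
Qed.

End stieltjes_tower.

Lemma derive1n_alternating_tower (R : realType) (u : nat -> R -> R) (f : R -> R) :
  alternating_tower u -> (forall x, 0 < x -> f x = u 0%N x) ->
  forall (n : nat) (x : R), 0 < x ->
    derive1n n f x = (-1) ^+ n * u n x /\ derivable (derive1n n f) x 1.
Proof.
move=> Hu fu.
have step n (x : R) : 0 < x -> (forall y, 0 < y -> derive1n n f y = (-1) ^+ n * u n y) ->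
    is_derive x 1 (derive1n n f) ((-1) ^+ n.+1 * u n.+1 x).
  move=> x0 E; have [du _] := Hu n x x0.
  have dZ : is_derive x 1 ((-1) ^+ n \*: u n) ((-1) ^+ n.+1 * u n.+1 x).
    by apply: is_derive_eq; rewrite /GRing.scale/= exprS mulN1r mulNr mulrN.
  (* [f] is controlled only on the positive half-line; this suffices because the half-line is a
     neighbourhood of [x]. *)
  apply: near_eq_is_derive dZ.
  near=> y; rewrite E//.
  by near: y; exact: lt_nbhsr.
have main n : forall y : R, 0 < y -> derive1n n f y = (-1) ^+ n * u n y.
  elim: n => [|n IH] y y0; first by rewrite derive1n0 expr0 mul1r fu.
  by rewrite derive1nS derive1E; have [_ ->] := step n y y0 IH.
by move=> n x x0; split; [exact: main|have [] := step n x x0 (main n)].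
Unshelve. all: by end_near.
Qed.

(** * Necessity of the derivative conditions *)

Lemma gen_stieltjes_smooth_F_ge0 (R : realType) (lam : R) (f : R -> R) :
  0 < lam -> gen_stieltjes lam f ->
  smooth_pos f /\ forall (n k : nat) (x : R), 0 < x -> 0 <= F_lam lam f n k x.
Proof.
move=> lam0 [C [rho [C0 [_ frho]]]].
have irho : kernel_integrable rho lam by move=> x x0; have [] := frho x x0.
have Hu := stieltjes_tower_alternating lam0 C0 irho.
have fu x : 0 < x -> f x = stieltjes_tower lam C rho 0 x.
  move=> x0; have [ix fx] := frho x x0.
  rewrite /stieltjes_tower add0r divff ?gt_eqF ?Gamma_gt0// mul1r addrC.
  apply: EFin_inj; rewrite fx EFinD /kernel_integral /Rintegral fineK//.
  exact: integrable_fin_num ix.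
have der := derive1n_alternating_tower Hu fu.
split=> [n x x0|n k x x0]; first by have [] := der n x x0.
rewrite /F_lam mulr_sumr.
have := stieltjes_tower_binomial_sum_ge0 lam0 C0 irho n k x0.
congr (0 <= _); apply: eq_bigr => j _.
have [-> _] := der (n + j)%N x x0.
rewrite exprD [(- x) ^+ _]exprNn.
have : ((-1) ^+ n * (-1) ^+ n = 1 :> R) by rewrite -expr2 sqrr_sign.
move: ((-1) ^+ n) => e e2.
set a := 'C(k, j)%:R; set b := _ / _; set c := (-1) ^+ j; set d := x ^+ j.
set w := stieltjes_tower _ _ _ _ _.
by transitivity (e * e * (a * b * (c * d) * w)); [rewrite e2 mul1r|ring].
Qed.

(** * From the moment measure to the Stieltjes measure *)

(* The density w is realised as Lebesgue measure on the region under the graph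
   of w, whose first marginal is then pushed forward by tau. *)
Lemma weighted_pushforward (R : realType) (w tau : R -> R) :
  measurable_fun setT w -> measurable_fun setT tau -> (forall x, 0 <= w x) ->
  exists nu : {measure set R -> \bar R}, forall f : R -> \bar R,
    measurable_fun setT f -> (forall x, 0 <= f x)%E ->
    (\int[nu]_x f x = \int[@lebesgue_measure R]_x (f (tau x) * (w x)%:E))%E.
Proof.
move=> mw mtau w0.
pose T := measurableTypeR R.
pose mu : {sigma_finite_measure set T -> \bar R} := @lebesgue_measure R.
pose E : set (T * T) := [set z | (0 : R) <= z.2] `&` [set z | (z.2 : R) < w z.1].
have msnd : measurable_fun (setT : set (T * T)) (fun z : T * T => z.2 : R).
  exact: measurable_snd.
have mwfst : measurable_fun (setT : set (T * T)) (fun z : T * T => w z.1).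
  exact: (measurableT_comp mw (@measurable_fst _ _ T T)).
have mphi : measurable_fun (setT : set (T * T)) (fun z : T * T => tau z.1).
  exact: (measurableT_comp mtau (@measurable_fst _ _ T T)).
have mE : measurable E.
  apply: measurableI.
    have := @measurable_fun_ler _ (T * T)%type R setT (cst 0) (fun z : T * T => z.2)
      (@measurable_cst _ _ _ _ _ _) msnd.
    by move=> /(_ measurableT [set true]); rewrite setTI; exact.
  have := @measurable_fun_ltr _ (T * T)%type R setT (fun z : T * T => z.2) _ msnd mwfst.
  by move=> /(_ measurableT [set true]); rewrite setTI; exact.
pose m : {measure set (T * T)%type -> \bar R} :=
  measure_function_mrestr__canonical__measure_function_Measure (mu \x mu)%E mE.
exists (measure_function_pushforward__canonical__measure_function_Measure m mphi) => f mf f0.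
have mf1 : measurable_fun (setT : set (T * T)) (fun z : T * T => f (tau z.1)).
  exact: (measurableT_comp mf mphi).
transitivity (\int[m]_(z in (fun z : T * T => tau z.1) @^-1` setT) f (tau z.1))%E.
  by apply: (ge0_integral_pushforward mphi).
rewrite preimage_setT.
have m0 : m (~` E) = 0%E.
  by rewrite /m /= /mrestr setICl measure0.
rewrite (@ge0_negligible_integral _ _ _ m setT (~` E))//; last exact: measurableC.
rewrite setDE setCK setTI.
rewrite (@eq_measure_integral _ _ _ E (mu \x mu)%E); last first.
  by move=> A mA AE; rewrite /m /= /mrestr setIidl.
rewrite integral_mkcond.
have -> : ((fun z : T * T => f (tau z.1)) \_ E) = (fun z : T * T => f (tau z.1) * (\1_E z)%:E)%E.
  by apply/funext => z; rewrite epatch_indic.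
rewrite (fubini_tonelli1 (fun z : T * T => f (tau z.1) * (\1_E z)%:E)%E); last 2 first.
- by apply: emeasurable_funM => //; apply/measurable_EFinP; exact: measurable_indic.
- by move=> z; rewrite mule_ge0// lee_fin.
apply: eq_integral => s _; rewrite /fubini_F/=.
(* The fibre of [E] above [s] is [[0, w s[], whose length is the density [w s]. *)
have mI : measurable (`[0, w s[%classic : set R) by exact: measurable_itv.
under eq_integral.
  move=> y _.
  rewrite (_ : \1_E (s, y) = \1_(`[0, w s[%classic : set R) y); last first.
    rewrite !indicE; congr (_ %:R); congr nat_of_bool.
    apply/idP/idP; rewrite !inE /E/= in_itv/=; first by case=> -> ->.
    by move=> /andP[].
  over.
rewrite ge0_integralZl//; last by apply/measurable_EFinP; exact: measurable_indic.
congr (_ * _)%E.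
rewrite integral_indic// setIT /= lebesgue_measure_itv/= lte_fin.
by have := w0 s; rewrite le_eqVlt => /predU1P[<-|->]; rewrite ?ltxx ?sube0.
Qed.

Section stieltjes_measure_of_quantile.
Context {R : realType} (lam A : R) (Q : R -> R).
Hypotheses (lam0 : 0 < lam) (Q_nd : {homo Q : x y / x <= y})
  (Q01 : forall x, 0 <= Q x <= 1).

Let leb := @lebesgue_measure R.
Let S : set R := `[0, A] `&` [set s | 0 < Q s].

Let mS : measurable S.
Proof.
apply: measurableI; first exact: measurable_itv.
have mQ : measurable_fun setT Q by exact: nondecreasing_measurable.
have := @measurable_fun_ltr _ R R setT (cst 0) Q (@measurable_cst _ _ _ _ _ _) mQ.
by move=> /(_ measurableT [set true]); rewrite setTI; exact.
Qed.

(* u = 1 / (1 + t) carries the moment variable u in ]0, 1] to the Stieltjes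
   variable t; the atom of the moment measure at u = 0 becomes the constant C. *)
Lemma stieltjes_measure_of_quantile : exists (C : R) (rho : {measure set R -> \bar R}),
  [/\ 0 <= C, rho [set t | t < 0] = 0%E, kernel_integrable rho lam &
    forall n : nat, (if n is 0 then C else 0) + kernel_integral rho (n%:R + lam) 1 =
      \int[leb]_(s in `[0, A]) (Q s ^+ n)].
Proof.
have mQ : measurable_fun setT Q by exact: nondecreasing_measurable.
pose w s := \1_S s * Q s `^ (- lam).
pose tau s := Q s `^ (-1) - 1.
have mw : measurable_fun setT w.
  apply: measurable_funM; first exact: measurable_indic.
  exact: (measurableT_comp (@measurable_powR R (- lam)) mQ).
have mtau : measurable_fun setT tau.
  apply: measurable_funB => //.
  exact: (measurableT_comp (@measurable_powR R (-1)) mQ).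
have w0 s : 0 <= w s by rewrite mulr_ge0 ?powR_ge0.
have [rho rhoE] := weighted_pushforward mw mtau w0.
have mD : measurable (`[(0%R : R), +oo[%classic : set R) by exact: measurable_itv.
have tau_ge0 s : S s -> 0 <= tau s.
  move=> [_ /= Qs]; have /andP[Q0 Q1] := Q01 s.
  by rewrite subr_ge0 powR_inv1// invf_ge1.
(* Since [x + tau s = (1 - Q s + x * Q s) / Q s], the density [Q s ^ (-lam)] cancels all but
   [Q s ^+ n] of the power of [Q s] produced by the kernel. At [x = 1] the base is 1 and the plain
   moment remains. *)
have kE n x : 0 < x -> (\int[rho]_(t in `[(0%R : R), +oo[) ((x + t) `^ (- (n%:R + lam)))%:E =
    \int[leb]_(s in S) (Q s ^+ n * (1 - Q s + x * Q s) `^ (- (n%:R + lam)))%:E)%E.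
  move=> x0.
  rewrite integral_mkcond rhoE; last 2 first.
  - apply/(measurable_restrictT _ mD); apply/measurable_EFinP; exact: measurable_kernel.
  - by move=> t; apply: erestrict_ge0 => u _; rewrite lee_fin powR_ge0.
  rewrite [RHS]integral_mkcond; apply: eq_integral => s _.
  rewrite !patchE /w indicE; case: ifPn => [/set_mem /= tI|tI].
    case: (boolP (s \in S)) => [/set_mem sS|sS]; last by rewrite mul0r mule0.
    have Qs : 0 < Q s by case: sS.
    rewrite mul1r -EFinM; congr (_%:E).
    have xt : 0 < x + tau s by rewrite ltr_wpDr// tau_ge0.
    have -> : 1 - Q s + x * Q s = Q s * (x + tau s).
      by rewrite /tau powR_inv1 ?ltW//; field; rewrite gt_eqF.
    rewrite powRM ?ltW// mulrA [in LHS]mulrC; congr (_ * _).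
    rewrite opprD powRD ?(gt_eqF Qs) ?implybT// powR_invn ?ltW// mulrA.
    by rewrite divff ?mul1r// expf_neq0// gt_eqF.
  case: (boolP (s \in S)) => [/set_mem sS|sS]; last by rewrite mul0r mule0.
  exfalso; move/negP: tI; apply; rewrite inE /= in_itv/= andbT.
  exact: tau_ge0.
have S_fin : (leb S < +oo)%E.
  apply: (@le_lt_trans _ _ (leb `[0, A])).
    by apply: le_measure; rewrite ?inE//; exact: subIsetl.
  by rewrite /leb lebesgue_measure_itv/=; case: ifP => // _; rewrite -EFinB ltry.
have mker (n : nat) x : measurable_fun setT
    (fun s : measurableTypeR R => (Q s ^+ n * (1 - Q s + x * Q s) `^ (- (n%:R + lam)))%:E).
  apply/measurable_EFinP; apply: measurable_funM; first exact: measurable_funX.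
  apply: (measurableT_comp (@measurable_powR R _)).
  apply: measurable_funD; first exact: measurable_funB.
  exact: measurable_funM.
have irho : kernel_integrable rho lam.
  move=> x x0; apply/integrableP; split.
    by apply/measurable_EFinP; exact: measurable_kernel.
  under eq_integral do rewrite /= ger0_norm ?powR_ge0//.
  have := kE 0%N x x0; rewrite add0r => ->.
  (* [1 - Q s + x * Q s] is a convex combination of 1 and [x], hence at least [c]. *)
  set c := Num.min 1 x.
  have c0 : 0 < c by rewrite lt_min ltr01.
  apply: (@le_lt_trans _ _ (\int[leb]_(s in S) (c `^ (- lam))%:E)%E).
    apply: ge0_le_integral => //.
    - by move=> s _; rewrite lee_fin mulr_ge0 ?powR_ge0.
    - by have := mker 0%N x; rewrite add0r => mk; exact: (measurable_funTS mk).
    - move=> s [_ /= Qs]; have /andP[Q0 Q1] := Q01 s.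
      rewrite lee_fin expr0 mul1r.
      have cQ : c <= 1 - Q s + x * Q s.
        by rewrite /c; case: (lerP 1 x) => x1; nra.
      rewrite !powRN lef_pV2 ?posrE ?powR_gt0 ?(lt_le_trans c0)//.
      by rewrite ge0_ler_powR ?nnegrE ?(ltW lam0) ?(ltW c0)// (le_trans _ cQ)// ltW.
  by rewrite integral_cst// lte_mul_pinfty// lee_fin powR_ge0.
(* The constant is the length of the zero set of [Q] in [[0, A]], that is, the mass of the moment
   measure at 0. *)
exists (fine (leb (`[0, A] `\` S))), rho; split => //.
- exact: fine_ge0.
- have mneg : measurable ([set t : R | t < 0]).
    by rewrite -set_itvNyo; exact: measurable_itv.
  rewrite -[X in rho X]setIT -integral_indic// rhoE; last 2 first.
  + by apply/measurable_EFinP; exact: measurable_indic.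
  + by move=> t; rewrite lee_fin.
  apply: integral0_eq => s _; rewrite /w !indicE.
  case: (boolP (s \in S)) => [/set_mem sS|sS]; last by rewrite mul0r mule0.
  rewrite (_ : (tau s \in _) = false) ?mul0e//.
  by apply/negbTE; rewrite notin_setE/= ltNge tau_ge0.
- move=> n.
  have -> : kernel_integral rho (n%:R + lam) 1 = \int[leb]_(s in S) (Q s ^+ n).
    rewrite /kernel_integral /Rintegral kE//; congr fine.
    by apply: eq_integral => s _; rewrite mul1r subrK powR1 mulr1.
  have mN : measurable (`[0, A] `\` S) by apply: measurableD => //; exact: measurable_itv.
  have -> : (if n is 0 then fine (leb (`[0, A] `\` S)) else 0) =
      \int[leb]_(s in `[0, A] `\` S) (Q s ^+ n).
    (* As [0 ^+ 0 = 1], the zero set contributes its whole length to the moment of order 0 and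
       nothing to the others. *)
    rewrite (@eq_Rintegral _ _ _ _ _ (cst (0 ^+ n))); last first.
      move=> s /set_mem [sA sS]; have /andP[Q0 _] := Q01 s.
      suff -> : Q s = 0 by [].
      by apply/eqP; rewrite eq_le Q0 andbT leNgt; apply/negP => Qs; apply: sS.
    by rewrite Rintegral_cst//; case: n => [|n]; rewrite ?expr0 ?mul1r// expr0n mul0r.
  have SA : (`[0, A] `\` S) `|` S = `[0, A]%classic by rewrite setUC setDUK//; exact: subIsetl.
  rewrite -Rintegral_setU//; first by rewrite SA.
  + rewrite SA; apply: integrable_homo_bounded.
      move=> x y xy; have /andP[Qx _] := Q01 x.
      by rewrite lerXn2r ?nnegrE ?Q_nd// (le_trans Qx)// Q_nd.
    by move=> x; have /andP[Q0 Q1] := Q01 x; rewrite exprn_ge0//= exprn_ile1.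
  + by apply/disj_setPS => s [[_ nS] /nS].
Qed.

End stieltjes_measure_of_quantile.

(** * Sufficiency of the derivative conditions *)

Lemma smooth_F_ge0_alternating (R : realType) (lam : R) (f : R -> R) :
  0 < lam -> smooth_pos f ->
  (forall (n k : nat) (x : R), 0 < x -> 0 <= F_lam lam f n k x) ->
  alternating_tower (fun n x => (-1) ^+ n * derive1n n f x).
Proof.
move=> lam0 smf F0 n x x0; split.
  have ? : is_derive x 1 (derive1n n f) (derive1n n.+1 f x).
    by rewrite derive1nS derive1E; exact/derivableP/smf.
  have -> : (fun x => (-1) ^+ n * derive1n n f x) = (-1) ^+ n \*: derive1n n f by [].
  by apply: is_derive_eq; rewrite /GRing.scale/= exprS mulN1r mulNr opprK.
have := F0 n 0%N x x0; rewrite /F_lam big_ord1 bin0 addn0 divff ?mul1r//.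
by rewrite gt_eqF// Gamma_nat_gt0.
Qed.

Lemma hausdorff_diff_F_lam (R : realType) (lam : R) (f : R -> R) (n k : nat) : 0 < lam ->
  hausdorff_diff (fun m => (-1) ^+ m * derive1n m f 1 / Gamma (m%:R + lam)) k n =
  F_lam lam f n k 1 / Gamma ((n + k)%:R + lam).
Proof.
move=> lam0; rewrite /F_lam mulr_sumr mulr_suml; apply: eq_bigr => j _.
have G0 : Gamma ((n + k)%:R + lam) != 0 by rewrite gt_eqF// Gamma_nat_gt0.
have H0 : Gamma ((n + j)%:R + lam) != 0 by rewrite gt_eqF// Gamma_nat_gt0.
have e2 : ((-1) ^+ j * (-1) ^+ j = 1 :> R) by rewrite -expr2 sqrr_sign.
rewrite expr1n exprD mulr1.
move: (Gamma ((n + k)%:R + lam)) (Gamma ((n + j)%:R + lam)) G0 H0 => g h g0 h0.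
transitivity (((-1) ^+ j * (-1) ^+ j) *
  ((-1) ^+ n * 'C(k, j)%:R * derive1n (n + j) f 1 / h)); first by ring.
by rewrite e2; field; rewrite g0 h0.
Qed.

Lemma smooth_F_ge0_gen_stieltjes (R : realType) (lam : R) (f : R -> R) :
  0 < lam -> smooth_pos f ->
  (forall (n k : nat) (x : R), 0 < x -> 0 <= F_lam lam f n k x) -> gen_stieltjes lam f.
Proof.
move=> lam0 smf F0.
have Hu := smooth_F_ge0_alternating lam0 smf F0.
have Gl := Gamma_gt0 lam0.
pose b m := (-1) ^+ m * derive1n m f 1 / Gamma (m%:R + lam).
(* The factor [Gamma lam] matches the denominator in [stieltjes_tower]: multiplying the n-th moment
   by [Gamma (n%:R + lam) / Gamma lam] then gives [(-1)^n] times the n-th derivative of [f] at 1. *)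
have [Q [Qnd Q01 Qmom]] : exists Q : R -> R,
    [/\ {homo Q : x y / x <= y}, (forall x, 0 <= Q x <= 1) &
    forall m, \int[@lebesgue_measure R]_(x in `[0, Gamma lam * b 0%N]) (Q x ^+ m)
      = Gamma lam * b m].
  apply: (@hausdorff_moment R (fun m => Gamma lam * b m)) => n k.
  have -> : hausdorff_diff (fun m => Gamma lam * b m) k n = Gamma lam * hausdorff_diff b k n.
    by rewrite /hausdorff_diff mulr_sumr; apply: eq_bigr => j _; rewrite mulrCA.
  rewrite hausdorff_diff_F_lam// mulr_ge0 ?(ltW Gl)// divr_ge0 ?F0//.
  exact/ltW/Gamma_nat_gt0.
have [C [rho [C0 rho0 irho kerE]]] :=
  stieltjes_measure_of_quantile (Gamma lam * b 0%N) lam0 Qnd Q01.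
have Hv := stieltjes_tower_alternating lam0 C0 irho.
have fE x : 0 < x -> f x = stieltjes_tower lam C rho 0 x.
  move=> x0.
  have := alternating_tower_eq Hu Hv _ x0; rewrite expr0 mul1r derive1n0; apply => n.
  have Gn : Gamma (n%:R + lam) != 0 by rewrite gt_eqF// Gamma_nat_gt0.
  have := kerE n; rewrite Qmom => /(congr1 (fun z => Gamma (n%:R + lam) / Gamma lam * z)).
  rewrite mulrA divfK ?gt_eqF// /b [RHS]mulrC divfK// => <-.
  rewrite /stieltjes_tower mulrDr addrC; congr (_ + _).
  case: n Gn => [|n] _; last by rewrite mulr0.
  by rewrite add0r divff ?mul1r ?gt_eqF.
exists C, rho; split => //; split => // x x0; split; first exact: irho.
rewrite fE// /stieltjes_tower add0r divff ?gt_eqF// mul1r addrC EFinD.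
rewrite /kernel_integral /Rintegral fineK//.
exact: (integrable_fin_num _ (irho x x0)).
Qed.

Unset Implicit Arguments.

Theorem theorem2 (R : realType) (lam : R) (f : R -> R) (hlam : 0 < lam) :
  gen_stieltjes lam f <->
  (smooth_pos f /\ forall (n k : nat) (x : R), 0 < x -> 0 <= F_lam lam f n k x).
Proof.
split; first exact: gen_stieltjes_smooth_F_ge0.
by case; exact: smooth_F_ge0_gen_stieltjes.
Qed.
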